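(* Let $x_0\in X$ and let $\{x_t\}$ be generated by the projected gradient method with constant parameter $\gamma_t=\gamma$ for all $t$, where $\gamma\ge L$ and $\gamma>0$, that is, $x_t=\arg\min_{x\in X}\{\langle\nabla f(x_{t-1}),x\rangle+\tfrac{\gamma}{2}\|x_{t-1}-x\|^2\}$ for $t\ge 1$. Let $g_{X,t}:=\gamma(x_t-x_{t+1})$, let $\mathcal E_X(x_0):=\{x\in X: f(x)\le f(x_0)\}$ and $D_{X,x_0}:=\max_{x,y\in\mathcal E_X(x_0)}\|x-y\|$. Then for every integer $k\ge1$ such that $\sum_{t=1}^k\big(\tfrac{2t-1}{2\gamma}-\tfrac{tL}{2\gamma^2}\big)>0$, $$\min_{0\le t\le k-1}\|g_{X,t}\|^2\le\Big(\sum_{t=1}^{k}\big(\tfrac{2t-1}{2\gamma}-\tfrac{tL}{2\gamma^2}\big)\Big)^{-1}\Big(\tfrac{\gamma}{2}\|x_0-x^*\|^2+\tfrac{lk}{2}D_{X,x_0}^2\Big).$$ Specifically, if $\gamma=L$ (with $L>0$), then for every $k\ge2$, $$\min_{0\le t\le k-1}\|g_{X,t}\|^2\le\frac{2L^2\|x_0-x^*\|^2}{k(k-1)}+\frac{2Ll\,D_{X,x_0}^2}{k-1}.$$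
   Context: $\|\cdot\|$ and $\langle\cdot,\cdot\rangle$ are Euclidean. $X\subseteq\mathbb R^n$ is a nonempty convex compact set and $f:X\to\mathbb R$ is continuously differentiable (possibly nonconvex). For some $L\ge0$, $\|\nabla f(x)-\nabla f(y)\|\le L\|x-y\|$ for all $x,y\in X$; consequently $f(x)-f(y)-\langle\nabla f(y),x-y\rangle\le\tfrac L2\|x-y\|^2$ for all $x,y\in X$. For some $l\in[0,L]$, $f(x)-f(y)-\langle\nabla f(y),x-y\rangle\ge-\tfrac l2\|x-y\|^2$ for all $x,y\in X$. $x^*$ denotes a minimizer of $f$ over $X$. *)

(* Defs.v *)
From HB Require Import structures.
From mathcomp Require Import all_boot all_order all_algebra.
From mathcomp Require Import all_classical all_reals all_analysis.
Import Order.TTheory GRing.Theory Num.Theory.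
Import numFieldNormedType.Exports.

Set Implicit Arguments.
Unset Strict Implicit.
Unset Printing Implicit Defensive.

Local Open Scope classical_set_scope.
Local Open Scope ring_scope.

Definition dotv (R : realType) (n : nat) (u v : 'rV[R]_n) : R :=
  \sum_(i < n) u 0 i * v 0 i.

(* The norm `|u| that the library puts on 'rV[R]_n is the sup norm, hence a
   separate Euclidean norm.  Both induce the same topology, so the library's
   [compact], [continuous] and limits can be used as they are. *)
Definition enorm (R : realType) (n : nat) (u : 'rV[R]_n) : R :=
  Num.sqrt (dotv u u).

(* [df] is a gradient of [f] on [X]: at each x of X, f is Frechet
   differentiable relative to X, that is,
     f(y) = f(x) + <df(x), y - x> + o(|y - x|)   as y -> x with y in X.
   Only the values of f and df on X matter, so that this is meaningful for
   a function whose domain is X, even where X has no interior; it holds in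
   particular if f is differentiable on an open neighbourhood of X and df is
   its gradient. *)
Definition is_gradient_on (R : realType) (n : nat) (X : set 'rV[R]_n)
    (f : 'rV[R]_n -> R) (df : 'rV[R]_n -> 'rV[R]_n) : Prop :=
  forall x, X x ->
    (f y - f x - dotv (df x) (y - x)) / enorm (y - x)
      @[y --> within X x^'] --> (0 : R).

Definition continuously_differentiable_on (R : realType) (n : nat)
    (X : set 'rV[R]_n) (f : 'rV[R]_n -> R) (df : 'rV[R]_n -> 'rV[R]_n) :
    Prop :=
  is_gradient_on X f df /\ {within X, continuous df}.

Definition is_argmin (R : realType) (T : Type) (X : set T) (h : T -> R)
    (x : T) : Prop :=
  X x /\ forall y, X y -> h x <= h y.

(* The objective is strongly convex for gamma > 0, so its minimizer over a
   convex set X is unique and [is_argmin] does determine x t.+1. *)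
Definition projected_gradient (R : realType) (n : nat) (X : set 'rV[R]_n)
    (df : 'rV[R]_n -> 'rV[R]_n) (gamma : R) (x : nat -> 'rV[R]_n) : Prop :=
  forall t : nat,
    is_argmin X
      (fun y => dotv (df (x t)) y + gamma / 2 * enorm (x t - y) ^+ 2)
      (x t.+1).

Definition projected_gradient_map (R : realType) (n : nat) (gamma : R)
    (x : nat -> 'rV[R]_n) (t : nat) : 'rV[R]_n :=
  gamma *: (x t - x t.+1).

Definition sublevel (R : realType) (T : Type) (X : set T) (f : T -> R)
    (x0 : T) : set T :=
  [set x | X x /\ f x <= f x0].

Definition distances (R : realType) (n : nat) (E : set 'rV[R]_n) : set R :=
  [set enorm (p.1 - p.2) | p in E `*` E].

Definition ediam (R : realType) (n : nat) (E : set 'rV[R]_n) : R :=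
  sup (distances E).

(* For nonempty compact E, in particular for a sublevel set of a continuous
   function on a compact set, the supremum defining [ediam E] is a maximum. *)
Lemma ediam_max (R : realType) (n : nat) (E : set 'rV[R]_n) :
  E !=set0 -> compact E ->
  distances E (ediam E) /\ forall d, distances E d -> d <= ediam E.
Proof.
move=> [u Eu] cE.
have EE0 : E `*` E !=set0 by exists (u, u).
have h_cont : continuous
    (fun p : 'rV[R]_n * 'rV[R]_n => enorm (p.1 - p.2)).
  move=> p; apply: (@continuous_comp _ _ _
    (fun p : 'rV[R]_n * 'rV[R]_n => dotv (p.1 - p.2) (p.1 - p.2)) Num.sqrt);
    last exact: sqrt_continuous.
  apply: cvg_big; [exact: add_continuous|].
  move=> i _; rewrite !mxE.
  have c : continuous (fun p : 'rV[R]_n * 'rV[R]_n => (p.1 - p.2) 0 i).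
    move=> q; rewrite /continuous_at !mxE.
    under eq_fun do rewrite !mxE.
    apply: cvgB.
    - exact: (@continuous_comp _ _ _ fst (fun M : 'rV[R]_n => M 0 i) q
        cvg_fst (@coord_continuous _ _ _ 0 i _)).
    - exact: (@continuous_comp _ _ _ snd (fun M : 'rV[R]_n => M 0 i) q
        cvg_snd (@coord_continuous _ _ _ 0 i _)).
  have := c p; rewrite /continuous_at !mxE => cp.
  exact: cvgM.
have [c /set_mem EEc cmax] := compact_EVT_max EE0 (compact_setX cE cE)
  (continuous_subspaceT h_cont).
have ubc : ubound (distances E) (enorm (c.1 - c.2)).
  by move=> _ [p EEp <-]; apply: cmax; apply/mem_set.
have dc : distances E (enorm (c.1 - c.2)) by exists c.
have -> : ediam E = enorm (c.1 - c.2).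
  apply/eqP; rewrite eq_le; apply/andP; split.
  - by apply: ge_sup => //; exists (enorm (c.1 - c.2)).
  - by apply: ub_le_sup => //; exists (enorm (c.1 - c.2)).
by split.
Qed.

(* min_{0 <= t <= k - 1} a t, for k >= 1: the default value a 0 of the big
   operator is then itself one of the terms. *)
Definition min_upto (R : realType) (a : nat -> R) (k : nat) : R :=
  \big[Num.min/a 0%N]_(0 <= t < k) a t.

(* Main.v *)
Require Import Defs.
From HB Require Import structures.
From mathcomp Require Import all_boot all_order all_algebra.
From mathcomp Require Import all_classical all_reals all_analysis.
From mathcomp Require Import ring lra.
Import Order.TTheory GRing.Theory Num.Theory.
Import numFieldNormedType.Exports.

(** Write d t = |x t - xstar|, c = 1 / gamma - L / (2 gamma^2), and D for the
    diameter of the initial sublevel set.  Three facts are combined.  The Lipschitz gradient gives the quadratic upper bound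
    ([descent]).  Convexity of X and optimality of x t.+1 in the strongly convex
    subproblem give the three-point inequality ([argmin_three_point]).  The
    lower curvature bound compares the linearization of f at x t with f itself,
    up to the error (l / 2) |y - x t|^2.  Adding them yields, for every y in X,
    the one-step inequality [PG_step].

    With y = x t it says that f decreases by at least c |g t|^2 at step t
    ([PG_decrease]), so the iterates never leave the initial sublevel set.
    With y = xstar it bounds f (x t.+1) - f xstar by a telescoping difference of
    (gamma / 2) (d t)^2, minus (gamma - L) / (2 gamma^2) |g t|^2, plus
    (l / 2) D^2.  Summing the latter over k steps, and estimating each
    f (x t) - f xstar from below by the decreases that are still to come, the
    term |g t|^2 receives the weight t c + (gamma - L) / (2 gamma^2), which is
    the summand of index t + 1 in the weight sum of the theorem ([wS]).
    Induction on k organizes this double sum ([PG_potential]); as the weights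
    are nonnegative, replacing every |g t|^2 by the minimum gives the first
    claim.  For gamma = L the weights sum to k (k - 1) / (4 L), whence the
    second.

    The quadratic upper bound concerns a gradient that is only relative to X,
    which may have empty interior: f is therefore restricted to a segment of
    X, where it is continuous up to the end points and differentiable inside,
    and the mean value theorem applies. *)

Set Implicit Arguments.
Unset Strict Implicit.

Local Open Scope classical_set_scope.
Local Open Scope ring_scope.

(** * Euclidean inner product and norm *)

Section Euclidean.
Context {R : realType} {n : nat}.
Implicit Types u v w : 'rV[R]_n.

Lemma dotvC u v : dotv u v = dotv v u.
Proof. by apply: eq_bigr => i _; rewrite mulrC. Qed.

Lemma dotvDl u v w : dotv (u + v) w = dotv u w + dotv v w.
Proof. by rewrite -big_split; apply: eq_bigr => i _; rewrite mxE mulrDl. Qed.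

Lemma dotvZl a u v : dotv (a *: u) v = a * dotv u v.
Proof. by rewrite /dotv big_distrr; apply: eq_bigr => i _; rewrite mxE -mulrA. Qed.

Lemma dotvNl u v : dotv (- u) v = - dotv u v.
Proof. by rewrite -scaleN1r dotvZl mulN1r. Qed.

Lemma dotvDr u v w : dotv u (v + w) = dotv u v + dotv u w.
Proof. by rewrite dotvC dotvDl !(dotvC _ u). Qed.

Lemma dotvZr a u v : dotv u (a *: v) = a * dotv u v.
Proof. by rewrite dotvC dotvZl dotvC. Qed.

Lemma dotvNr u v : dotv u (- v) = - dotv u v.
Proof. by rewrite dotvC dotvNl dotvC. Qed.

Definition dotvE := (dotvDl, dotvDr, dotvNl, dotvNr, dotvZl, dotvZr).

Lemma dotv_ge0 u : 0 <= dotv u u.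
Proof. by apply: sumr_ge0 => i _; rewrite -expr2 sqr_ge0. Qed.

Lemma dotv_eq0 u : (dotv u u == 0) = (u == 0).
Proof.
rewrite psumr_eq0 => [|i _]; last by rewrite -expr2 sqr_ge0.
apply/allP/eqP => [u0|-> i _]; last by rewrite mxE mulr0 eqxx implybT.
apply/rowP => i; rewrite mxE.
by have := u0 i (mem_index_enum i); rewrite /= mulf_eq0 orbb => /eqP.
Qed.

Lemma enorm_ge0 u : 0 <= enorm u.
Proof. exact: sqrtr_ge0. Qed.

Lemma enorm_sqr u : enorm u ^+ 2 = dotv u u.
Proof. by rewrite sqr_sqrtr ?dotv_ge0. Qed.

Lemma enorm_eq0 u : (enorm u == 0) = (u == 0).
Proof. by rewrite -sqrf_eq0 enorm_sqr dotv_eq0. Qed.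

Lemma enormZ a u : enorm (a *: u) = `|a| * enorm u.
Proof.
by rewrite /enorm dotvZl dotvZr mulrA -expr2 sqrtrM ?sqr_ge0// sqrtr_sqr.
Qed.

(** Cauchy-Schwarz, from the nonnegativity of the square of
    |v| u - |u| v, which is 2 |u| |v| (|u| |v| - <u, v>). *)
Lemma dotv_le_enorm u v : dotv u v <= enorm u * enorm v.
Proof.
have [->|u0] := eqVneq u 0.
  by rewrite -(scale0r 0) dotvZl mul0r mulr_ge0 ?enorm_ge0.
have [->|v0] := eqVneq v 0.
  by rewrite -(scale0r 0) dotvZr mul0r mulr_ge0 ?enorm_ge0.
have a0 : 0 < enorm u by rewrite lt_def enorm_eq0 u0 enorm_ge0.
have b0 : 0 < enorm v by rewrite lt_def enorm_eq0 v0 enorm_ge0.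
have := dotv_ge0 (enorm v *: u - enorm u *: v).
rewrite !dotvE (dotvC v u) -!enorm_sqr => h.
rewrite -(ler_pM2l (mulr_gt0 a0 b0)); nra.
Qed.

End Euclidean.

(** * The objective along a segment of the feasible set *)

Section Segment.
Context {R : realType} {n : nat}.
Implicit Types (u v : 'rV[R]_n) (X : set 'rV[R]_n).

Lemma convex_segment X u v (s : R) : convex_set X -> X u -> X v ->
  0 <= s <= 1 -> X (v + s *: (u - v)).
Proof.
move=> cX Xu Xv /andP[s0 s1].
have /set_mem := cX u v (Itv01 s0 s1) (mem_set Xu) (mem_set Xv).
congr X; rewrite /conv /= /unstable.onem scalerBl scalerBr scale1r.
by rewrite addrCA.
Qed.

(** The relative gradient transfers to the segment because r |-> v + r (u - v)
    tends to its value at s while staying in X, and, if u <> v, avoids that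
    value for r <> s, as the punctured limit requires.  The estimate includes
    the end points s = 0 and s = 1, where only one-sided information exists. *)
Lemma gradient_on_segment X (f : 'rV[R]_n -> R) df u v (s e : R) :
  is_gradient_on X f df -> convex_set X -> X u -> X v -> 0 <= s <= 1 -> 0 < e ->
  \forall r \near s, 0 <= r <= 1 ->
    `|f (v + r *: (u - v)) - f (v + s *: (u - v))
      - (r - s) * dotv (df (v + s *: (u - v))) (u - v)| <= e * `|r - s|.
Proof.
move=> df_f cX Xu Xv s01 e0.
have [->|uv] := eqVneq u v.
  apply: filterE => r _; rewrite !subrr !scaler0.
  by rewrite -(scale0r 0) dotvZr mul0r mulr0 !subrr normr0 mulr_ge0// ltW.
set d := u - v; set p := fun r : R => v + r *: d.
have d0 : d != 0 by rewrite subr_eq0.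
have nd0 : 0 < enorm d by rewrite lt_def enorm_eq0 d0 enorm_ge0.
have pr_ps r : p r - p s = (r - s) *: d.
  by rewrite /p opprD addrACA subrr add0r scalerBl.
have p_cont : p r @[r --> s] --> p s.
  by apply: cvgD; [exact: cvg_cst|apply: cvgZr_tmp; exact: cvg_id].
have Xps : X (p s) by exact: convex_segment.
have /cvgrPdist_lt/(_ (e / enorm d)) := df_f _ Xps.
rewrite divr_gt0// => /(_ isT) near_ps.
near=> r => r01.
have H : p r != p s -> X (p r) ->
    `|0 - (f (p r) - f (p s) - dotv (df (p s)) (p r - p s))
      / enorm (p r - p s)| < e / enorm d.
  by near: r; exact: p_cont near_ps.
have [->|rs] := eqVneq r s.
  by rewrite !subrr mul0r subrr normr0 mulr0.
have Hr : p r != p s by rewrite -subr_eq0 pr_ps scaler_eq0 subr_eq0 negb_or rs d0.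
have := H Hr (convex_segment cX Xu Xv r01).
rewrite -/(p r) pr_ps enormZ sub0r normrN dotvZr normrM normfV normrM normr_id.
rewrite (ger0_norm (enorm_ge0 _)).
have rs0 : 0 < `|r - s| by rewrite normr_gt0 subr_eq0.
rewrite ltr_pdivrMr ?mulr_gt0// => /ltW/le_trans; apply.
by rewrite [leLHS](_ : _ = e * `|r - s|)//; field; exact: lt0r_neq0.
Unshelve. all: by end_near. Qed.

Lemma continuous_on_segment X (f : 'rV[R]_n -> R) df u v :
  is_gradient_on X f df -> convex_set X -> X u -> X v ->
  {within `[0, 1], continuous (fun r : R => f (v + r *: (u - v)))}.
Proof.
move=> df_f cX Xu Xv; apply/subspace_continuousP => s /= s01.
rewrite in_itv /= in s01.
set c := dotv (df (v + s *: (u - v))) (u - v).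
apply/cvgrPdist_le => e e0.
rewrite near_withinE; near=> r => /=; rewrite in_itv /= => r01.
have slope : `|f (v + r *: (u - v)) - f (v + s *: (u - v)) - (r - s) * c|
    <= 1 * `|r - s|.
  move: r01; near: r.
  exact: gradient_on_segment df_f cX Xu Xv s01 ltr01.
have rs : `|s - r| <= e / (1 + `|c|).
  near: r.
  have /cvgrPdist_le : r @[r --> s] --> s by exact: cvg_id.
  by apply; rewrite divr_gt0// ltr_wpDr.
rewrite distrC ler_pdivlMr ?ltr_wpDr// in rs.
rewrite distrC.
have -> : f (v + r *: (u - v)) - f (v + s *: (u - v)) =
   (f (v + r *: (u - v)) - f (v + s *: (u - v)) - (r - s) * c) + (r - s) * c by ring.
rewrite (le_trans (ler_normD _ _))// normrM; lra.
Unshelve. all: by end_near. Qed.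

(** Inside the segment the restriction to [0, 1] is invisible near s, so the
    relative expansion gives a genuine two-sided derivative. *)
Lemma derive_on_segment X (f : 'rV[R]_n -> R) df u v (s : R) :
  is_gradient_on X f df -> convex_set X -> X u -> X v -> s \in `]0, 1[ ->
  is_derive s 1 (fun r : R => f (v + r *: (u - v)))
    (dotv (df (v + s *: (u - v))) (u - v)).
Proof.
move=> df_f cX Xu Xv s01.
set c := dotv _ _; set phi := fun r => _.
suff H : h^-1 *: (phi (h *: 1 + s) - phi s) @[h --> 0^'] --> (c : R).
  by apply: DeriveDef; [apply/cvg_ex; exists c|exact/cvg_lim].
have s01' : 0 <= s <= 1.
  by move: s01; rewrite in_itv/= => /andP[/ltW -> /ltW ->].
apply/cvgrPdist_le => e e0.
have near_s := gradient_on_segment df_f cX Xu Xv s01' e0.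
have /nbhs0P near_s01 : \forall r \near s, r \in `]0, 1[.
  exact: near_in_itvoo.
move/nbhs0P in near_s.
near=> h.
have h0 : h != 0 by near: h; exact: nbhs_dnbhs_neq.
have sh01 : s + h \in `]0, 1[ by near: h; exact: nbhs_dnbhs.
have slope : 0 <= s + h <= 1 ->
    `|phi (s + h) - phi s - (s + h - s) * c| <= e * `|s + h - s|.
  by near: h; exact: nbhs_dnbhs.
have {}slope : `|phi (s + h) - phi s - h * c| <= e * `|h|.
  move: slope; rewrite (addrC s) addrK; apply; rewrite addrC.
  by move: sh01; rewrite in_itv/= => /andP[/ltW -> /ltW ->].
rewrite [_ *: 1]mulr1 (addrC h).
rewrite distrC -(ler_pM2r (_ : 0 < `|h|)) ?normr_gt0// -normrM.
by rewrite mulrBl [_ *: _ * h]mulrAC mulVf// mul1r (mulrC c).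
Unshelve. all: by end_near. Qed.

End Segment.

(** * Inequalities for one step *)

Section Descent.
Context {R : realType} {n : nat}.
Variables (X : set 'rV[R]_n) (f : 'rV[R]_n -> R) (df : 'rV[R]_n -> 'rV[R]_n).
Variable L : R.
Hypothesis X_convex : convex_set X.
Hypothesis df_f : is_gradient_on X f df.
Hypothesis df_lipschitz : forall u v, X u -> X v ->
  enorm (df u - df v) <= L * enorm (u - v).

(** The function psi obtained from r |-> f (v + r (u - v)) by subtracting
    the linear term r <df v, u - v> and (L / 2) |u - v|^2 r^2 has derivative
    <df (v + r (u - v)) - df v, u - v> - L r |u - v|^2, which is at most 0 by
    Cauchy-Schwarz and the Lipschitz bound; hence psi 1 <= psi 0.  The mean
    value theorem needs differentiability only inside the interval, and this
    is all that a gradient relative to X provides. *)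
Lemma descent u v : X u -> X v ->
  f u - f v - dotv (df v) (u - v) <= L / 2 * enorm (u - v) ^+ 2.
Proof.
move=> Xu Xv; set d := u - v; set b := dotv (df v) d.
pose p (r : R) := v + r *: d.
pose psi (r : R) := f (p r) - (b * r + L / 2 * enorm d ^+ 2 * r ^+ 2).
pose dpsi (r : R) := dotv (df (p r)) d - (b + L * enorm d ^+ 2 * r).
have psi_derive (r : R) : r \in `]0, 1[%R -> is_derive r 1 psi (dpsi r).
  move=> r01; apply: is_deriveB.
    exact: derive_on_segment df_f X_convex Xu Xv r01.
  apply: is_derive_eq; rewrite /GRing.scale /=; lra.
have psi_cont : {within `[0, 1], continuous psi}.
  apply/subspace_continuousP => r r01; apply: cvgB.
    have := continuous_on_segment df_f X_convex Xu Xv.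
    by move/subspace_continuousP; apply.
  apply: cvg_within_filter.
  apply: cvgD; first exact: mulrl_continuous.
  by apply: cvgM; [exact: cvg_cst|]; exact: exprn_continuous.
have [c] := MVT_segment ler01 psi_derive psi_cont.
rewrite in_itv /= => c01.
have Xpc : X (p c) by exact: convex_segment.
have /andP[c0 _] := c01.
have slope : dotv (df (p c)) d - b <= L * enorm d ^+ 2 * c.
  rewrite -dotvNl -dotvDl (le_trans (dotv_le_enorm _ _))//.
  rewrite expr2 mulrA mulrAC ler_wpM2r ?enorm_ge0//.
  rewrite (le_trans (df_lipschitz Xpc Xv))// /p addrAC subrr add0r.
  by rewrite enormZ ger0_norm// -mulrA (mulrC c).
have p1 : p 1 = u by rewrite /p scale1r addrC subrK.
have p0 : p 0 = v by rewrite /p scale0r addr0.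
rewrite /psi /dpsi p1 p0; lra.
Qed.

End Descent.

(** The objective is a quadratic whose leading part is (gamma / 2) |.|^2, so
    the claim amounts to the first-order optimality condition
    0 <= <a - gamma (z - q), y - q>, called A below.  It follows by comparing q
    with the points q + t (y - q) of X for small t. *)
Lemma argmin_three_point (R : realType) (n : nat) (X : set 'rV[R]_n)
    (a z q y : 'rV[R]_n) (gamma : R) :
  convex_set X -> 0 <= gamma ->
  is_argmin X (fun y => dotv a y + gamma / 2 * enorm (z - y) ^+ 2) q -> X y ->
  dotv a (q - y) + gamma / 2 * enorm (z - q) ^+ 2 + gamma / 2 * enorm (q - y) ^+ 2
    <= gamma / 2 * enorm (z - y) ^+ 2.
Proof.
move=> cX gamma0 [Xq q_min] Xy.
set w := y - q; set e := z - q.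
have -> : q - y = - w by rewrite opprB.
have -> : z - y = e - w by rewrite opprB addrA subrK.
have w_def : w = y - q by [].
have e_def : z - q = e by [].
clearbody w e.
set A := dotv a w - gamma * dotv e w; set B := gamma / 2 * dotv w w.
have B0 : 0 <= B by rewrite mulr_ge0 ?divr_ge0 ?dotv_ge0.
suff A0 : 0 <= A.
  by move: A0; rewrite /A !enorm_sqr !dotvE (dotvC w e); nra.
rewrite leNgt; apply/negP => A0.
have AB t : 0 <= t <= 1 -> 0 <= A * t + B * t ^+ 2.
  move=> t01.
  have := q_min _ (convex_segment cX Xy Xq t01).
  rewrite -w_def opprD addrA e_def !enorm_sqr !dotvE (dotvC w e) /A /B; nra.
(* t = - A / (B - A) lies in [0, 1] and makes A t + B t^2 = A t^2 < 0. *)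
have BA : 0 < B - A by lra.
have := AB (- A / (B - A)).
rewrite divr_ge0 ?ler_pdivrMr ?mul1r; [|lra|lra|lra].
have -> : A * (- A / (B - A)) + B * (- A / (B - A)) ^+ 2 =
  (A / (B - A)) ^+ 2 * A by field; lra.
have -> : - A <= B - A by lra.
move=> /(_ isT); apply/negP; rewrite -ltNge pmulr_rlt0//.
by rewrite exprn_even_gt0//= mulf_neq0 ?invr_neq0//; lra.
Qed.

(** * Diameter and minimum *)

(** The supremum bounds the distances in E because they are bounded above,
    namely by the diameter of the compact superset X. *)
Lemma le_ediam (R : realType) (n : nat) (X E : set 'rV[R]_n) u v :
  compact X -> E `<=` X -> E u -> E v -> enorm (u - v) <= ediam E.
Proof.
move=> cX EX Eu Ev; apply: ub_le_sup; last by exists (u, v).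
have [_ ub] := ediam_max (ex_intro _ u (EX _ Eu)) cX.
exists (ediam X) => _ [[a b] /= [Ea Eb] <-].
by apply: ub; exists (a, b) => //; split; exact: EX.
Qed.

Lemma min_upto_le (R : realType) (a : nat -> R) k i :
  (i < k)%N -> min_upto a k <= a i.
Proof. by move=> ik; apply: ge_bigmin_seq; rewrite // mem_index_iota. Qed.

(** * Convergence of the projected gradient method *)

Section ProjectedGradient.
Context {R : realType} {n : nat}.
Variables (X : set 'rV[R]_n) (f : 'rV[R]_n -> R) (df : 'rV[R]_n -> 'rV[R]_n).
Variables (L l gamma : R) (x : nat -> 'rV[R]_n).
Hypotheses (X_convex : convex_set X) (X_compact : compact X).
Hypothesis df_f : is_gradient_on X f df.
Hypothesis df_lipschitz : forall u v, X u -> X v ->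
  enorm (df u - df v) <= L * enorm (u - v).
Hypothesis l_ge0 : 0 <= l.
Hypothesis f_lower_curvature : forall u v, X u -> X v ->
  f u - f v - dotv (df v) (u - v) >= - (l / 2) * enorm (u - v) ^+ 2.
Hypotheses (gamma_ge_L : L <= gamma) (gamma_gt0 : 0 < gamma).
Hypotheses (x0_in_X : X (x 0%N)) (x_PG : projected_gradient X df gamma x).

Let g := projected_gradient_map gamma x.

Lemma PG_in t : X (x t).
Proof. by case: t => [//|t]; have [] := x_PG t. Qed.

Lemma enorm_g t : enorm (x t - x t.+1) ^+ 2 = enorm (g t) ^+ 2 / gamma ^+ 2.
Proof.
rewrite /g /projected_gradient_map enormZ ger0_norm ?ltW//.
by field; exact: lt0r_neq0.
Qed.

(** The sum of three inequalities: the descent lemma from x t to x t.+1, the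
    lower curvature bound between x t and y, and the three-point inequality.
    The inner products with df (x t) cancel. *)
Lemma PG_step y t : X y ->
  f (x t.+1) - f y + (gamma - L) / (2 * gamma ^+ 2) * enorm (g t) ^+ 2
  <= gamma / 2 * enorm (x t - y) ^+ 2 - gamma / 2 * enorm (x t.+1 - y) ^+ 2
     + l / 2 * enorm (y - x t) ^+ 2.
Proof.
move=> Xy.
have := argmin_three_point X_convex (ltW gamma_gt0) (x_PG t) Xy.
have := descent X_convex df_f df_lipschitz (PG_in t.+1) (PG_in t).
have := f_lower_curvature Xy (PG_in t).
have -> : enorm (x t.+1 - x t) ^+ 2 = enorm (x t - x t.+1) ^+ 2.
  by rewrite -opprB -scaleN1r enormZ normrN1 mul1r.
have -> : (gamma - L) / (2 * gamma ^+ 2) * enorm (g t) ^+ 2 =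
    (gamma - L) / 2 * enorm (x t - x t.+1) ^+ 2.
  by rewrite enorm_g; field; exact: lt0r_neq0.
rewrite !dotvE; lra.
Qed.

(** The case y = x t of the one-step inequality. *)
Lemma PG_decrease t :
  f (x t.+1) + (gamma^-1 - L / (2 * gamma ^+ 2)) * enorm (g t) ^+ 2 <= f (x t).
Proof.
have := PG_step t (PG_in t).
rewrite subrr -(scale0r 0) enormZ normr0 mul0r expr0n /= !mulr0.
have -> : enorm (x t.+1 - x t) ^+ 2 = enorm (g t) ^+ 2 / gamma ^+ 2.
  by rewrite -enorm_g -opprB -scaleN1r enormZ normrN1 mul1r.
have -> : (gamma - L) / (2 * gamma ^+ 2) * enorm (g t) ^+ 2 =
  (gamma^-1 - L / (2 * gamma ^+ 2)) * enorm (g t) ^+ 2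
  - gamma / 2 * (enorm (g t) ^+ 2 / gamma ^+ 2).
  by field; exact: lt0r_neq0.
lra.
Qed.

Lemma PG_coef_ge0 : 0 <= gamma^-1 - L / (2 * gamma ^+ 2).
Proof.
have -> : gamma^-1 - L / (2 * gamma ^+ 2) = (2 * gamma - L) / (2 * gamma ^+ 2).
  by field; exact: lt0r_neq0.
apply: divr_ge0; last by rewrite mulr_ge0 ?exprn_ge0 ?ltW.
move: gamma_ge_L gamma_gt0; lra.
Qed.

Lemma PG_sublevel t : sublevel X f (x 0%N) (x t).
Proof.
split; first exact: PG_in.
elim: t => [//|t]; apply: le_trans.
apply: le_trans (PG_decrease t); rewrite lerDl.
by rewrite mulr_ge0 ?PG_coef_ge0 ?sqr_ge0.
Qed.

Let w (t : nat) : R := (2 * t%:R - 1) / (2 * gamma) - t%:R * L / (2 * gamma ^+ 2).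

(** The two contributions to the weight of the squared norm of g t: the
    objective decrease at step t, counted once for each of the t earlier
    objective values that are compared with the final one, and the surplus
    left by the one-step inequality. *)
Lemma wS t : w t.+1 =
  t%:R * (gamma^-1 - L / (2 * gamma ^+ 2)) + (gamma - L) / (2 * gamma ^+ 2).
Proof. by rewrite /w -natr1; field; exact: lt0r_neq0. Qed.

Lemma wS_ge0 t : 0 <= w t.+1.
Proof.
rewrite wS addr_ge0 ?mulr_ge0 ?ler0n ?PG_coef_ge0//.
  by rewrite subr_ge0.
by rewrite invr_ge0 mulr_ge0 ?exprn_ge0 ?ltW.
Qed.

(** Going from k to k + 1, the gap f (x k) - f xstar, present k times, pays for
    k decreases of the objective, and the one-step inequality with y = xstar
    supplies the additional gap while telescoping the distance to xstar.  Its
    curvature error is at most (l / 2) D^2 since both xstar and x k lie in the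
    initial sublevel set. *)
Lemma PG_potential xstar k : is_argmin X f xstar ->
  \sum_(1 <= t < k.+1) w t * enorm (g t.-1) ^+ 2 + k%:R * (f (x k) - f xstar)
    + gamma / 2 * enorm (x k - xstar) ^+ 2
  <= gamma / 2 * enorm (x 0%N - xstar) ^+ 2
     + l * k%:R / 2 * ediam (sublevel X f (x 0%N)) ^+ 2.
Proof.
move=> [Xs s_min]; set D := ediam _.
elim: k => [|k IH].
  by rewrite big_geq// mul0r mulr0 !mul0r add0r addr0 add0r.
rewrite big_nat_recr//= wS -[k.+1%:R]natr1.
have dist_D : enorm (xstar - x k) ^+ 2 <= D ^+ 2.
  have xD : enorm (xstar - x k) <= D.
    apply: (le_ediam X_compact) => //; first by move=> ? [].
      by split => //; exact: s_min.
    exact: PG_sublevel.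
  by rewrite lerXn2r ?nnegrE ?enorm_ge0// (le_trans _ xD) ?enorm_ge0.
have step := PG_step k Xs.
have lD : l / 2 * enorm (xstar - x k) ^+ 2 <= l / 2 * D ^+ 2.
  by rewrite ler_wpM2l// divr_ge0.
have kdec : k%:R * (f (x k.+1) + (gamma^-1 - L / (2 * gamma ^+ 2)) * enorm (g k) ^+ 2)
   <= k%:R * f (x k) by rewrite ler_wpM2l// PG_decrease.
lra.
Qed.

Lemma PG_min_bound xstar k : is_argmin X f xstar ->
  (\sum_(1 <= t < k.+1) w t) * min_upto (fun t => enorm (g t) ^+ 2) k
  <= gamma / 2 * enorm (x 0%N - xstar) ^+ 2
     + l * k%:R / 2 * ediam (sublevel X f (x 0%N)) ^+ 2.
Proof.
move=> s_argmin; apply: le_trans (PG_potential k s_argmin).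
have gap_ge0 : 0 <= k%:R * (f (x k) - f xstar).
  by rewrite mulr_ge0 // subr_ge0; apply: s_argmin.2; exact: PG_in.
have dist_ge0 : 0 <= gamma / 2 * enorm (x k - xstar) ^+ 2.
  by rewrite mulr_ge0 ?sqr_ge0// divr_ge0// ltW.
suff : (\sum_(1 <= t < k.+1) w t) * min_upto (fun t => enorm (g t) ^+ 2) k
    <= \sum_(1 <= t < k.+1) w t * enorm (g t.-1) ^+ 2 by lra.
rewrite big_distrl /= !big_nat; apply: ler_sum => -[//|t] /andP[_ tk].
by rewrite ler_wpM2l ?wS_ge0// (min_upto_le (fun t => enorm (g t) ^+ 2)).
Qed.

End ProjectedGradient.

Lemma sum_weights (R : realType) (L : R) k : 0 < L ->
  \sum_(1 <= t < k.+1) ((2 * t%:R - 1) / (2 * L) - t%:R * L / (2 * L ^+ 2)) =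
  k%:R * (k%:R - 1) / (4 * L).
Proof.
move=> L0; elim: k => [|k IH]; first by rewrite big_geq// !mul0r.
by rewrite big_nat_recr//= IH -natr1; field; exact: lt0r_neq0.
Qed.

Unset Implicit Arguments.
Set Strict Implicit.

Theorem theorem1 (R : realType) (n : nat)
  (X : set 'rV[R]_n)
  (f : 'rV[R]_n -> R) (df : 'rV[R]_n -> 'rV[R]_n)
  (L l gamma : R)
  (xstar : 'rV[R]_n) (x : nat -> 'rV[R]_n)
  (X_nonempty : X !=set0)
  (X_convex : convex_set X)
  (X_compact : compact X)
  (f_C1 : continuously_differentiable_on X f df)
  (L_ge0 : 0 <= L)
  (df_lipschitz : forall u v, X u -> X v ->
     enorm (df u - df v) <= L * enorm (u - v))
  (l_ge0 : 0 <= l)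
  (l_le_L : l <= L)
  (f_lower_curvature : forall u v, X u -> X v ->
     f u - f v - dotv (df v) (u - v) >= - (l / 2) * enorm (u - v) ^+ 2)
  (xstar_min : is_argmin X f xstar)
  (gamma_ge_L : L <= gamma)
  (gamma_gt0 : 0 < gamma)
  (x0_in_X : X (x 0%N))
  (x_PG : projected_gradient X df gamma x) :
  let g := projected_gradient_map gamma x in
  let D := ediam (sublevel X f (x 0%N)) in
  let W (k : nat) : R :=
    \sum_(1 <= t < k.+1)
      ((2 * t%:R - 1) / (2 * gamma) - t%:R * L / (2 * gamma ^+ 2)) in
  (forall k : nat, (1 <= k)%N -> 0 < W k ->
     min_upto (fun t => enorm (g t) ^+ 2) k
       <= (W k)^-1 * (gamma / 2 * enorm (x 0%N - xstar) ^+ 2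
                      + l * k%:R / 2 * D ^+ 2))
  /\
  (gamma = L -> 0 < L ->
   forall k : nat, (2 <= k)%N ->
     min_upto (fun t => enorm (g t) ^+ 2) k
       <= 2 * L ^+ 2 * enorm (x 0%N - xstar) ^+ 2 / (k%:R * (k%:R - 1))
          + 2 * L * l * D ^+ 2 / (k%:R - 1)).
Proof.
move=> g D W.
have [df_f _] := f_C1.
have main k : W k * min_upto (fun t => enorm (g t) ^+ 2) k
    <= gamma / 2 * enorm (x 0%N - xstar) ^+ 2 + l * k%:R / 2 * D ^+ 2.
  exact: (PG_min_bound X_convex X_compact df_f df_lipschitz l_ge0
    f_lower_curvature gamma_ge_L gamma_gt0 x0_in_X x_PG k xstar_min).
have first k : (1 <= k)%N -> 0 < W k ->
    min_upto (fun t => enorm (g t) ^+ 2) k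
    <= (W k)^-1 * (gamma / 2 * enorm (x 0%N - xstar) ^+ 2
                   + l * k%:R / 2 * D ^+ 2).
  by move=> _ Wk; rewrite mulrC ler_pdivlMr// mulrC.
split=> // gammaL L0 k k2.
have k1 : 0 < k%:R - 1 :> R by rewrite subr_gt0 ltr1n.
have k0 : 0 < k%:R :> R by rewrite ltr0n; exact: ltn_trans k2.
have Wk : W k = k%:R * (k%:R - 1) / (4 * L) by rewrite /W gammaL sum_weights.
have := first k (ltnW k2); rewrite Wk gammaL.
have -> : 0 < k%:R * (k%:R - 1) / (4 * L) by rewrite divr_gt0 ?mulr_gt0.
move=> /(_ isT); congr (_ <= _).
by field; rewrite !lt0r_neq0.
Qed.
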